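(* Let $c,k>0$, $\gamma>1$ and $P(\rho)=k^2\rho^\gamma$. For the Cauchy problem for the $(3+1)$-dimensional relativistic Euler equations $$\Big(\frac{\rho+P|u|^2/c^4}{1-|u|^2/c^2}\Big)_t+\mathrm{div}\Big(\frac{(\rho+P/c^2)u}{1-|u|^2/c^2}\Big)=0,\qquad \Big(\frac{(\rho+P/c^2)u}{1-|u|^2/c^2}\Big)_t+\mathrm{div}\Big(\frac{\rho+P/c^2}{1-|u|^2/c^2}\,u\otimes u\Big)+\nabla P=0,$$ with $(\rho,u)|_{t=0}=(\rho_0,u_0)$ on $\mathbb{R}^3$, there is no solution $(\rho,u)\in D(\infty)$ satisfying $$\limsup_{t\to+\infty}\|u(t,\cdot)\|_{L^\infty(\mathbb{R}^3)}=0.$$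
   Context: Put $\tilde\rho=\dfrac{\rho+P/c^2}{1-|u|^2/c^2}$, $\hat\rho=\dfrac{\rho+P|u|^2/c^4}{1-|u|^2/c^2}=\dfrac1{c^2}\tilde\rho|u|^2+\rho$, total energy $m(t)=\int_{\mathbb{R}^3}\hat\rho(t,x)\,dx$ and momentum $\mathbb{P}(t)=\int_{\mathbb{R}^3}\tilde\rho(t,x)u(t,x)\,dx$. Solution class $D(T)$: $(\rho,u)\in D(T)$ if it satisfies the Cauchy problem in the sense of distributions and (A) $\rho\ge0$, $(\rho,u)\in C^1([0,T)\times\mathbb{R}^3)$; (B) $|u|<c$ and $\sqrt{P'(\rho)}<c$; (C) $0<m(0)=m(t)<\infty$ for any $t\in[0,T]$; (D) $0<|\mathbb{P}(0)|=|\mathbb{P}(t)|<\infty$ for any $t\in[0,T]$. For $T=\infty$ these conditions are required for all $t\in[0,\infty)$. *)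

(* Defs.v *)
From HB Require Import structures.
From mathcomp Require Import all_boot all_order all_algebra.
From mathcomp Require Import all_classical all_reals all_analysis.

Set Implicit Arguments.
Unset Strict Implicit.
Unset Printing Implicit Defensive.

Import Order.TTheory GRing.Theory Num.Theory.
Import numFieldNormedType.Exports.

Local Open Scope classical_set_scope.
Local Open Scope ring_scope.

Section euclidean_space.
Context {R : realType}.

(* The norm `|x| on row vectors is the sup norm; |x| in the Euler equations is
   the Euclidean norm. *)
Definition enorm (x : 'rV[R]_3) : R := Num.sqrt (\sum_(i < 3) x 0 i ^+ 2).

(* Row vectors carry no Lebesgue measure: integrals over R^3 are taken on
   R * R * R with the product measure and transported along the coordinates. *)
Definition mu1 : {sigma_finite_measure set (measurableTypeR R) -> \bar R} :=
  @lebesgue_measure R.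
Local Notation RM := (measurableTypeR R).
Local Notation RM3 := ((RM * RM * RM)%type : measurableType _).
Definition mu3 : {measure set RM3 -> \bar R} := ((mu1 \x mu1) \x mu1)%E.

(* Space-time measure on pairs (x, t), in this order: the library makes m \x m'
   a measure only when m' is canonically sigma-finite. *)
Local Notation RM4 := ((RM * RM * RM * RM)%type : measurableType _).
Definition mu4 : {measure set RM4 -> \bar R} := (mu3 \x mu1)%E.

Definition vec3 (p : R * R * R) : 'rV[R]_3 :=
  \row_(i < 3) [:: p.1.1; p.1.2; p.2]`_i.

Definition unitv (i : 'I_3) : 'rV[R]_3 := delta_mx 0 i.

Definition Linfty (v : 'rV[R]_3 -> 'rV[R]_3) : \bar R :=
  Lnorm mu3 +oo%E (fun p => (enorm (v (vec3 p)))%:E).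

End euclidean_space.

Section function_classes.
Context {R : realType}.

(* [0, T) x R^3, for T possibly +oo *)
Definition slab (T : \bar R) : set (R * 'rV[R]_3) :=
  [set p | 0 <= p.1 /\ (p.1%:E < T)%E].

Definition open_slab (T : \bar R) : set (R * 'rV[R]_3) :=
  [set p | 0 < p.1 /\ (p.1%:E < T)%E].

(* Continuously differentiable up to the boundary t = 0, where the time
   derivative is one-sided. *)
Definition C1_slab (T : \bar R) (f : R -> 'rV[R]_3 -> R) : Prop :=
  exists (ft : R -> 'rV[R]_3 -> R) (fx : 'I_3 -> R -> 'rV[R]_3 -> R),
    [/\ {within slab T, continuous (fun p => f p.1 p.2)},
        {within slab T, continuous (fun p => ft p.1 p.2)},
        forall i, {within slab T, continuous (fun p => fx i p.1 p.2)} &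
        forall t x, slab T (t, x) ->
          ((fun h => h^-1 * (f (t + h) x - f t x))
             @ within [set h | 0 <= t + h] 0^' --> ft t x) /\
          (forall i, is_derive x (unitv i) (f t) (fx i t x))].

Definition smooth (phi : R * 'rV[R]_3 -> R) : Prop :=
  forall vs : seq (R * 'rV[R]_3),
    let g := foldr (fun v h => derive h ^~ v) phi vs in
    continuous g /\ forall p v, derivable g p v.

Definition test_function (T : \bar R) (phi : R * 'rV[R]_3 -> R) : Prop :=
  let supp := closure [set p | phi p != 0] in
  [/\ smooth phi, compact supp & supp `<=` open_slab T].

(* q_t + div F = 0 in the sense of distributions on (0, T) x R^3 *)
Definition balance_law (T : \bar R) (q : R -> 'rV[R]_3 -> R)
    (F : 'I_3 -> R -> 'rV[R]_3 -> R) : Prop :=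
  forall phi, test_function T phi ->
    (\int[mu4]_(z in [set z | open_slab T (z.2, vec3 z.1)])
       (let t := z.2 in let x := vec3 z.1 in
        q t x * 'D_((1, 0) : R * 'rV[R]_3) phi (t, x) +
        \sum_(j < 3) F j t x * 'D_((0, unitv j) : R * 'rV[R]_3) phi (t, x))%:E
     = 0)%E.

End function_classes.

Section relativistic_euler.
Context {R : realType}.
Variables (c k gamma : R).

(* P(r) = k^2 r^gamma, extended by 0 to r < 0 so that the library derivative
   of P at r = 0 is the (one-sided) derivative of P on [0, +oo): the bare
   power function r `^ gamma equals 1 for r < 0. *)
Definition pressure (r : R) : R := k ^+ 2 * (Num.max r 0) `^ gamma.

Variables (rho : R -> 'rV[R]_3 -> R) (u : R -> 'rV[R]_3 -> 'rV[R]_3).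

Definition rho_tilde (t : R) (x : 'rV[R]_3) : R :=
  (rho t x + pressure (rho t x) / c ^+ 2) / (1 - enorm (u t x) ^+ 2 / c ^+ 2).

Definition rho_hat (t : R) (x : 'rV[R]_3) : R :=
  (rho t x + pressure (rho t x) * enorm (u t x) ^+ 2 / c ^+ 4) /
  (1 - enorm (u t x) ^+ 2 / c ^+ 2).

Definition energy (t : R) : \bar R :=
  (\int[mu3]_p (rho_hat t (vec3 p))%:E)%E.

Definition momentum_density (i : 'I_3) (t : R) (x : 'rV[R]_3) : R :=
  rho_tilde t x * u t x 0 i.

Definition momentum (t : R) : 'rV[R]_3 :=
  \row_i Rintegral mu3 setT (fun p => momentum_density i t (vec3 p)).

Definition finite_momentum (t : R) : Prop :=
  forall i, mu3.-integrable setT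
              (fun p => (momentum_density i t (vec3 p))%:E).

Definition cauchy_problem (rho0 : 'rV[R]_3 -> R) (u0 : 'rV[R]_3 -> 'rV[R]_3)
    (T : \bar R) : Prop :=
  [/\ balance_law T rho_hat momentum_density,
      forall i, balance_law T (momentum_density i)
        (fun j t x => rho_tilde t x * u t x 0 i * u t x 0 j +
                      (i == j)%:R * pressure (rho t x)),
      rho 0 = rho0 & u 0 = u0].

(* The class D(T), for 0 < T <= +oo. The closed time interval [0, T] of the
   conservation conditions is [0, +oo) when T = +oo. *)
Definition solution_class (rho0 : 'rV[R]_3 -> R)
    (u0 : 'rV[R]_3 -> 'rV[R]_3) (T : \bar R) : Prop :=
  [/\ cauchy_problem rho0 u0 T,
      [/\ forall t x, slab T (t, x) -> 0 <= rho t x,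
          C1_slab T rho &
          forall i, C1_slab T (fun t x => u t x 0 i)],
      forall t x, slab T (t, x) ->
        enorm (u t x) < c /\ Num.sqrt (derive1 pressure (rho t x)) < c,
      forall t, 0 <= t -> (t%:E <= T)%E ->
        (0 < energy 0)%E /\ energy 0 = energy t /\ (energy t < +oo)%E &
      forall t, 0 <= t -> (t%:E <= T)%E ->
        0 < enorm (momentum 0) /\
        enorm (momentum 0) = enorm (momentum t) /\ finite_momentum t].

End relativistic_euler.

(* Main.v *)
(* Only the conservation laws matter. Since P'(rho) < c^2, the power law gives
   P <= c^2 rho, hence rho_tilde <= 2 rho_hat pointwise, and each component of
   the momentum at time t is at most 2 m(0) ||u(t)||_oo. As the velocity decays
   this becomes smaller than any positive constant, whereas |P(t)| = |P(0)| > 0. *)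

Require Import Defs.
From HB Require Import structures.
From mathcomp Require Import all_boot all_order all_algebra.
From mathcomp Require Import all_classical all_reals all_analysis.
From mathcomp Require Import ess_sup_inf measurable_realfun ring lra.
Import Order.TTheory GRing.Theory Num.Theory.
Import numFieldNormedType.Exports.
Import HBNNSimple.
Local Open Scope classical_set_scope.
Local Open Scope ring_scope.

(* The integral of a nonnegative function is a supremum over the simple functions
   below it, hence monotone even on functions that are not measurable. *)
Lemma ge0_le_integralT {d : measure_display} {T : measurableType d}
    {R : realType} (mu : {measure set T -> \bar R}) (f g : T -> \bar R) :
  (forall x, 0 <= f x)%E -> (forall x, f x <= g x)%E ->
  (\int[mu]_x f x <= \int[mu]_x g x)%E.
Proof.
move=> f0 fg.
have g0 x : (0 <= g x)%E by exact: le_trans (fg x).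
rewrite !ge0_integralTE//; apply: ereal_sup_le => _ [h hf <-].
by exists h => // x; exact: le_trans (fg x).
Qed.

(** As [f] is measurable, removing the null set [N] from the domain keeps its integral. The
    restriction is below [g] everywhere, so monotonicity applies to an arbitrary nonnegative [g]. *)
Lemma ae_ge0_le_integralT {d : measure_display} {T : measurableType d}
    {R : realType} (mu : {measure set T -> \bar R}) (f g : T -> \bar R) :
  measurable_fun setT f ->
  (forall x, 0 <= f x)%E -> (forall x, 0 <= g x)%E ->
  (\forall x \ae mu, f x <= g x)%E ->
  (\int[mu]_x f x <= \int[mu]_x g x)%E.
Proof.
move=> mf f0 g0 [N [mN N0 fgN]].
rewrite (ge0_negligible_integral mN _ mf _ N0)// integral_mkcond.
apply: ge0_le_integralT => x; first exact: erestrict_ge0.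
rewrite patchE; case: ifPn => // /set_mem[_ Nx].
by apply: contrapT => fgx; exact/Nx/fgN.
Qed.

Lemma normr_Rintegral_le_ae {d : measure_display} {T : measurableType d}
    {R : realType} (mu : {measure set T -> \bar R}) (f g : T -> R) (a M : R) :
  0 < a -> mu.-integrable setT (EFin \o f) -> (forall x, 0 <= g x) ->
  (\forall x \ae mu, `|f x| <= a * g x) ->
  (\int[mu]_x (g x)%:E <= M%:E)%E ->
  `|Rintegral mu setT f| <= a * M.
Proof.
move=> a0 intf g0 fg gM.
have mf := measurable_int _ intf.
have mnf : measurable_fun setT (abse \o (EFin \o f)) by exact: measurableT_comp.
rewrite -lee_fin EFin_normr_Rintegral//.
apply: le_trans (le_abse_integral _ _ mf) _ => //.
(* The factor [a] is moved to the side of [f], where measurability lets it pass under the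
   integral. *)
rewrite EFinM -lee_pdivrMl// -ge0_integralZl//; last first.
  by rewrite lee_fin invr_ge0 ltW.
apply: le_trans gM; apply: ae_ge0_le_integralT.
- exact: measurable_funeM.
- by move=> x; rewrite mule_ge0// lee_fin invr_ge0 ltW.
- by move=> x; rewrite lee_fin.
- by apply: filterS fg => x; rewrite -EFinM lee_fin ler_pdivrMl.
Qed.

Section euclidean_norm.
Context {R : realType}.
Implicit Type x : 'rV[R]_3.

Lemma enorm_ge0 x : 0 <= enorm x.
Proof. exact: sqrtr_ge0. Qed.

Lemma sqr_enorm x : enorm x ^+ 2 = \sum_(i < 3) x 0 i ^+ 2.
Proof. by rewrite sqr_sqrtr// sumr_ge0// => i _; exact: sqr_ge0. Qed.

Lemma normr_le_enorm x i : `|x 0 i| <= enorm x.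
Proof.
rewrite -(@ler_pXn2r _ 2)// ?nnegrE ?enorm_ge0//.
rewrite sqr_enorm (bigD1 i)//= real_normK ?num_real// lerDl.
by apply: sumr_ge0 => j _; exact: sqr_ge0.
Qed.

(** The norm [Lnorm] at [+oo] is the essential supremum only on a space of positive measure, and 0
    otherwise. The unit cube has measure 1. *)
Lemma mu3T_gt0 : (0 < @mu3 R setT)%E.
Proof.
pose I : set (measurableTypeR R) := `[0, 1]%classic.
have mI : measurable I by exact: measurable_itv.
apply: (@lt_le_trans _ _ (mu3 (I `*` I `*` I))); last first.
  by apply: le_measure; rewrite ?inE//; do ! apply: measurableX.
have mu1I : mu1 I = 1%E.
  by rewrite /mu1/= lebesgue_measure_itv/= lte_fin ltr01 sube0.
rewrite [ltRHS]product_measure1E//; last exact: measurableX.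
by rewrite [X in (X * _)%E]product_measure1E// !mu1I !mule1 [ltRHS]mu1I lte_fin.
Qed.

Lemma Linfty_lt_ae (v : 'rV[R]_3 -> 'rV[R]_3) (e : R) :
  (Linfty v < e%:E)%E -> \forall p \ae @mu3 R, enorm (v (vec3 p)) <= e.
Proof.
rewrite /Linfty unlock mu3T_gt0 => /ltW/ess_supP.
by apply: filterS => p /=; rewrite lee_fin ger0_norm// enorm_ge0.
Qed.

End euclidean_norm.

(** The limit superior is an infimum of suprema over neighbourhoods of [+oo]. If it is below [e], so
    is one of these suprema, and that neighbourhood contains a nonnegative point. *)
Lemma limf_esup_pinfty_lt {R : realType} (f : R -> \bar R) (l e : \bar R) :
  limf_esup f (pinfty_nbhs R) = l -> (l < e)%E ->
  exists2 t, 0 <= t & (f t < e)%E.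
Proof.
move=> fl; rewrite -fl => /ereal_inf_lt[_ [V [M [_ MV]] <-] Ve].
exists (`|M| + 1); first by rewrite addr_ge0.
apply: le_lt_trans Ve; apply: ereal_sup_ubound; exists (`|M| + 1) => //.
by apply: MV; rewrite (le_lt_trans (ler_norm M))// ltrDl.
Qed.

Section pressure_bounds.
Context {R : realType}.
Variables (c k gamma : R).
Hypotheses (c_gt0 : 0 < c) (gamma_gt1 : 1 < gamma).

Lemma pressure_ge0 r : 0 <= pressure k gamma r.
Proof. by rewrite mulr_ge0 ?sqr_ge0 ?powR_ge0. Qed.

(** Near a positive [r] the truncation by [Num.max] is inactive. *)
Lemma derive1_pressure r : 0 < r ->
  derive1 (pressure k gamma) r = k ^+ 2 * (gamma * r `^ (gamma - 1)).
Proof.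
move=> r_gt0; rewrite derive1E.
have drE := is_derive1_powR gamma r_gt0.
rewrite (@near_eq_derive _ _ _ _ (fun x => k ^+ 2 * x `^ gamma))//.
  by rewrite deriveMl//= derive_val.
near=> x; rewrite /pressure max_l//; apply: ltW; near: x.
exact: lt_nbhsr.
Unshelve. all: by end_near. Qed.

(* Since r P'(r) = gamma P(r), subluminality of the sound speed bounds P
   itself. *)
Lemma pressure_le r : 0 <= r ->
  Num.sqrt (derive1 (pressure k gamma) r) < c ->
  pressure k gamma r <= c ^+ 2 * r.
Proof.
rewrite le_eqVlt => /predU1P[<- _|r_gt0].
  (* In the vacuum both sides vanish, as [gamma] is nonzero. *)
  by rewrite /pressure maxxx powR0 ?mulr0// gt_eqF// (lt_trans _ gamma_gt1).
rewrite derive1_pressure// => dPc.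
have dP0 : 0 <= k ^+ 2 * (gamma * r `^ (gamma - 1)).
  by rewrite mulr_ge0 ?sqr_ge0// mulr_ge0 ?powR_ge0// (le_trans ler01)// ltW.
have {}dPc : k ^+ 2 * (gamma * r `^ (gamma - 1)) < c ^+ 2.
  by rewrite -(sqr_sqrtr dP0) ltr_pXn2r// nnegrE ?sqrtr_ge0 ?ltW.
rewrite /pressure max_l ?(ltW r_gt0)//.
have -> : r `^ gamma = r `^ (gamma - 1) * r.
  by rewrite -{3}(powRr1 (ltW r_gt0)) -powRD ?subrK// (gt_eqF r_gt0) implybT.
rewrite mulrA ler_wpM2r ?(ltW r_gt0)//; apply: le_trans (ltW dPc).
by rewrite ler_wpM2l ?sqr_ge0// ler_peMl ?powR_ge0// ltW.
Qed.

Variables (rho : R -> 'rV[R]_3 -> R) (u : R -> 'rV[R]_3 -> 'rV[R]_3).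
Variables (t : R) (x : 'rV[R]_3).
Hypotheses (rho_ge0 : 0 <= rho t x) (u_lt : enorm (u t x) < c)
  (sound_lt : Num.sqrt (derive1 (pressure k gamma) (rho t x)) < c).

Lemma lorentz_gt0 : 0 < 1 - enorm (u t x) ^+ 2 / c ^+ 2.
Proof.
rewrite subr_gt0 ltr_pdivrMr ?exprn_gt0// mul1r ltr_pXn2r//.
  by rewrite nnegrE enorm_ge0.
by rewrite nnegrE ltW.
Qed.

Lemma rho_hat_ge0 : 0 <= rho_hat c k gamma rho u t x.
Proof.
rewrite divr_ge0 ?(ltW lorentz_gt0)// addr_ge0// divr_ge0//.
  by rewrite mulr_ge0 ?pressure_ge0 ?sqr_ge0.
by rewrite exprn_ge0// ltW.
Qed.

Lemma rho_tilde_ge0 : 0 <= rho_tilde c k gamma rho u t x.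
Proof.
rewrite divr_ge0 ?(ltW lorentz_gt0)// addr_ge0// divr_ge0 ?pressure_ge0//.
exact: sqr_ge0.
Qed.

(** The denominators agree, and the numerators satisfy rho + P/c^2 <= 2 rho <= 2 (rho + P
    |u|^2/c^4). *)
Lemma rho_tilde_le :
  rho_tilde c k gamma rho u t x <= 2 * rho_hat c k gamma rho u t x.
Proof.
rewrite mulrA ler_pM2r ?invr_gt0 ?lorentz_gt0//.
have Pc : pressure k gamma (rho t x) / c ^+ 2 <= rho t x.
  by rewrite ler_pdivrMr ?exprn_gt0// mulrC pressure_le.
have : 0 <= pressure k gamma (rho t x) * enorm (u t x) ^+ 2 / c ^+ 4.
  by rewrite divr_ge0 ?exprn_ge0 ?(ltW c_gt0)// mulr_ge0 ?pressure_ge0 ?sqr_ge0.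
lra.
Qed.

Lemma normr_momentum_density_le e i : enorm (u t x) <= e ->
  `|momentum_density c k gamma rho u i t x|
    <= 2 * e * rho_hat c k gamma rho u t x.
Proof.
move=> ue; rewrite normrM (ger0_norm rho_tilde_ge0) [leRHS]mulrAC.
apply: ler_pM (normr_ge0 _) rho_tilde_le _ => //.
  exact: rho_tilde_ge0.
exact: le_trans (normr_le_enorm _ _) ue.
Qed.

End pressure_bounds.

Theorem theorem3p5 (R : realType) (c k gamma : R)
    (c_gt0 : 0 < c) (k_gt0 : 0 < k) (gamma_gt1 : 1 < gamma)
    (rho0 : 'rV[R]_3 -> R) (u0 : 'rV[R]_3 -> 'rV[R]_3) :
  ~ exists (rho : R -> 'rV[R]_3 -> R) (u : R -> 'rV[R]_3 -> 'rV[R]_3),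
      solution_class c k gamma rho u rho0 u0 +oo%E /\
      limf_esup (fun t => Linfty (u t)) (pinfty_nbhs R) = 0%E.
Proof.
move=> [rho [u [[_ [rho_ge0 _ _] sub_c energyP momentumP] u_to0]]].
set p := enorm (momentum c k gamma rho u 0).
have p_gt0 : 0 < p by have [] := momentumP 0 (lexx _) (leey _).
have [m m_gt0 mE] : exists2 m : R, 0 < m & energy c k gamma rho u 0 = m%:E.
  have [E0 [EE Ey]] := energyP 0 (lexx _) (leey _).
  by case: (energy _ _ _ _ _ 0) E0 Ey => // m; rewrite lte_fin; exists m.
(* With this e, each component of the momentum is at most 2 e m = p / 2, while
   3 (p / 2)^2 < p^2. *)
pose e := p / (4 * m).
have e_gt0 : 0 < e by rewrite divr_gt0// mulr_gt0.
have [t t_ge0 ut] := limf_esup_pinfty_lt _ _ e%:E u_to0 e_gt0.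
have [_ [Et _]] := energyP t t_ge0 (leey _).
have [_ [Pt intP]] := momentumP t t_ge0 (leey _).
have slabt x : slab +oo%E (t, x) by split => //=; exact: ltry.
have Pi i : `|momentum c k gamma rho u t 0 i| <= p / 2.
  rewrite mxE.
  have -> : p / 2 = (2 * e) * m by rewrite /e; field; rewrite gt_eqF.
  apply: (normr_Rintegral_le_ae mu3 _
    (fun q => rho_hat c k gamma rho u t (vec3 q))).
  - by rewrite mulr_gt0.
  - exact: intP.
  - move=> q; have [uc _] := sub_c _ _ (slabt (vec3 q)).
    by apply: rho_hat_ge0 => //; exact: rho_ge0.
  - move: (Linfty_lt_ae _ _ ut).
    (* Only the bound on the velocity is restricted to almost every point; the bounds from [sub_c]
       and [rho_ge0] hold everywhere. *)
    apply: (@filterS _ _ (ae_filter_ringOfSetsType mu3)) => q ue.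
    have [uc sc] := sub_c _ _ (slabt (vec3 q)).
    by apply: normr_momentum_density_le => //; exact: rho_ge0.
  - by rewrite -mE Et.
(* Conservation turns p^2 into the sum of the squared components at time [t], so p^2 <= 3 p^2/4,
   against p > 0. *)
have : p ^+ 2 <= \sum_(i < 3) (p / 2) ^+ 2.
  rewrite /p Pt sqr_enorm ler_sum// => i _.
  rewrite -Pt -/p -real_normK ?num_real// ler_pXn2r// nnegrE// divr_ge0//.
  exact: ltW.
rewrite sumr_const card_ord.
have := exprn_gt0 2 p_gt0; lra.
Qed.
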